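(* Let $B$ be an antisymmetric Boolean semialgebra. Then $B$ is a Boolean algebra (with order $\sqsubset$) if and only if $\sqsubset$ is reflexive.
   Context: For a binary relation $\sqsubset$ on a set, let $a\preccurlyeq b$ mean: for all $c$, $c\sqsubset a$ implies $c\sqsubset b$, and $b\sqsubset c$ implies $a\sqsubset c$. Let $a\simeq b$ mean $a\preccurlyeq b$ and $b\preccurlyeq a$. A Heyting semialgebra $(H,\sqsubset,0,1,\sqcap,\sqcup,\rightarrow)$ is a set with a binary relation, constants $0,1$ and binary operations such that for all $a,b,c$: (H1) $\sqsubset$ is transitive; (H2) $(a\sqcap b)\sqcap c\simeq a\sqcap(b\sqcap c)$; (H3) $0\sqsubset a\sqsubset 1$; (H4) $c\sqsubset a\sqcap b$ iff $c\sqsubset a$ and $c\sqsubset b$; $a\preccurlyeq a\sqcap a$; $a\sqcap b\preccurlyeq a$ and $a\sqcap b\preccurlyeq b$; (H5) $a\sqcup b\sqsubset c$ iff $a\sqsubset c$ and $b\sqsubset c$; $a\preccurlyeq a\sqcup b$ and $b\preccurlyeq a\sqcup b$; $a\sqcup a\preccurlyeq a$; (H6) $a\sqcap b\sqsubset c$ iff $a\sqsubset (b\rightarrow c)$; if $a\sqsubset b$ then $c\preccurlyeq a\rightarrow(b\sqcap c)$; if $a\sqsubset b$ then $(b\rightarrow c)\sqcap a\preccurlyeq c$. Write $\neg a=a\rightarrow 0$. A Boolean semialgebra is a Heyting semialgebra with $a\sqcup b\simeq\neg a\rightarrow b$ and $\neg a\sqcup b\simeq a\rightarrow b$ for all $a,b$.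 It is antisymmetric if $a\simeq b$ implies $a=b$. *)

(* Defs.v *)
From HB Require Import structures.
From mathcomp Require Import all_boot all_order.

Set Implicit Arguments.
Unset Strict Implicit.
Unset Printing Implicit Defensive.

Definition preceq (T : Type) (R : T -> T -> Prop) (a b : T) : Prop :=
  forall c : T, (R c a -> R c b) /\ (R b c -> R a c).

Definition simeq (T : Type) (R : T -> T -> Prop) (a b : T) : Prop :=
  preceq R a b /\ preceq R b a.

(* No reflexivity, decidability or equality structure is assumed of [below]. *)
HB.mixin Record isHeytingSemialgebra (H : Type) := {
  below : H -> H -> Prop;
  bot : H;
  top : H;
  cap : H -> H -> H;
  cup : H -> H -> H;
  imp : H -> H -> H;
  below_trans : forall a b c : H, below a b -> below b c -> below a c;
  capA : forall a b c : H,
    simeq below (cap (cap a b) c) (cap a (cap b c));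
  bot_below : forall a : H, below bot a;
  below_top : forall a : H, below a top;
  below_cap : forall a b c : H,
    below c (cap a b) <-> below c a /\ below c b;
  preceq_capxx : forall a : H, preceq below a (cap a a);
  cap_preceql : forall a b : H, preceq below (cap a b) a;
  cap_preceqr : forall a b : H, preceq below (cap a b) b;
  cup_below : forall a b c : H,
    below (cup a b) c <-> below a c /\ below b c;
  preceq_cupl : forall a b : H, preceq below a (cup a b);
  preceq_cupr : forall a b : H, preceq below b (cup a b);
  cupxx_preceq : forall a : H, preceq below (cup a a) a;
  cap_below_imp : forall a b c : H,
    below (cap a b) c <-> below a (imp b c);
  preceq_imp_cap : forall a b c : H,
    below a b -> preceq below c (imp a (cap b c));
  imp_cap_preceq : forall a b c : H,
    below a b -> preceq below (cap (imp b c) a) c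
}.

#[short(type="heytingSemialgebraType")]
HB.structure Definition HeytingSemialgebra := {H of isHeytingSemialgebra H}.

Definition compl (H : heytingSemialgebraType) (a : H) : H := imp a bot.

HB.mixin Record HeytingSemialgebra_isBoolean (B : Type)
    of HeytingSemialgebra B := {
  cupE : forall a b : B,
    simeq below (cup a b) (imp (compl a) b);
  impE : forall a b : B,
    simeq below (cup (compl a) b) (imp a b)
}.

#[short(type="booleanSemialgebraType")]
HB.structure Definition BooleanSemialgebra :=
  {B of HeytingSemialgebra B & HeytingSemialgebra_isBoolean B}.

Definition antisymmetric_semialgebra (H : heytingSemialgebraType) : Prop :=
  forall a b : H, simeq below a b -> a = b.

Definition below_reflexive (H : heytingSemialgebraType) : Prop :=
  forall a : H, below a a.

(* The carrier itself bears a Boolean algebra structure, i.e. that of a bounded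
   complemented distributive lattice ([ctbDistrLatticeType]), whose order is
   [below] and whose operations are those of [H].  The trivial algebra, where
   bottom and top coincide, is allowed.  The library structure also contains a
   decidable equality and a choice operator; since it is only asserted to
   exist, these are no restriction in classical logic. *)
Definition is_boolean_algebra (H : heytingSemialgebraType) : Prop :=
  exists (d : Order.disp_t) (K : Order.CTBDistrLattice.axioms_ d H),
    let T : ctbDistrLatticeType d := Order.CTBDistrLattice.Pack K in
    [/\ forall a b : H, below a b <-> ((a : T) <= (b : T))%O,
        (bot : H) = (\bot%O : T) /\ (top : H) = (\top%O : T),
        forall a b : H, cap a b = ((a : T) `&` (b : T))%O :> H,
        forall a b : H, cup a b = ((a : T) `|` (b : T))%O :> H
      & (forall a : H, compl a = (~` (a : T))%O :> H) /\
        (forall a b : H, imp a b = (~` (a : T) `|` (b : T))%O :> H)].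

(* Main.v *)
Require Import Defs.
From HB Require Import structures.
From mathcomp Require Import all_boot all_order boolp.

(** Reflexivity together with transitivity makes [preceq] coincide with
    [below], so antisymmetry turns [below] into a partial order and each [simeq]
    of the axioms into an equality.  A reflexive Heyting semialgebra is then a
    residuated lattice, hence distributive, and the two Boolean axioms give
    [cup a (compl a) = imp (compl a) (compl a) = top]. *)

Lemma preceq_below (T : Type) (R : T -> T -> Prop) (a b : T) :
  R a a -> preceq R a b -> R a b.
Proof. by move=> Raa /(_ a)[/(_ Raa)]. Qed.

Lemma below_preceq (H : heytingSemialgebraType) (a b : H) :
  below a b -> preceq below a b.
Proof.
move=> ab c; split=> [ca|]; first exact: below_trans ca ab.
exact: below_trans ab.
Qed.

(* A copy of [B] mentioning the two hypotheses, so that the order instances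
   depending on them can be attached to a type. *)
Definition reflexive_carrier (B : booleanSemialgebraType)
  & antisymmetric_semialgebra B & below_reflexive B : Type := B.

Section ReflexiveCarrier.

Context (B : booleanSemialgebraType).
Context (antiB : antisymmetric_semialgebra B) (reflB : below_reflexive B).

Local Notation T := (reflexive_carrier B antiB reflB).

Lemma below_anti (a b : B) : below a b -> below b a -> a = b.
Proof. by move=> ab ba; apply: antiB; split; apply: below_preceq. Qed.

Lemma below_cupl (a b : B) : below a (cup a b).
Proof. exact: preceq_below (reflB a) (preceq_cupl a b). Qed.

Lemma below_cupr (a b : B) : below b (cup a b).
Proof. exact: preceq_below (reflB b) (preceq_cupr a b). Qed.

Lemma cap_belowl (a b : B) : below (cap a b) a.
Proof. by apply: preceq_below (cap_preceql a b). Qed.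

Lemma cap_belowr (a b : B) : below (cap a b) b.
Proof. by apply: preceq_below (cap_preceqr a b). Qed.

(* Residuation makes [cap^~ c] a left adjoint, hence it preserves joins. *)
Lemma cap_cupl (a b c : B) : cap (cup a b) c = cup (cap a c) (cap b c).
Proof.
apply: below_anti.
  apply/cap_below_imp/cup_below.
  by split; apply/cap_below_imp; [apply: below_cupl|apply: below_cupr].
have [al bl] := (below_cupl a b, below_cupr a b).
apply/cup_below; split; apply/below_cap; split; try exact: cap_belowr.
  exact: below_trans (cap_belowl a c) al.
exact: below_trans (cap_belowl b c) bl.
Qed.

Lemma cap_compl (a : B) : cap a (compl a) = bot.
Proof.
apply: below_anti (bot_below _).
(* Residuation moves the right factor, so the meet is commuted first; what remains is [compl a]
   below [imp a bot], an instance of reflexivity. *)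
suff: below (cap (compl a) a) bot.
  apply: below_trans; apply/below_cap.
  by split; [apply: cap_belowr|apply: cap_belowl].
exact/cap_below_imp.
Qed.

Lemma cup_complE (a b : B) : cup (compl a) b = imp a b.
Proof. exact/antiB/impE. Qed.

Lemma cup_compl (a : B) : cup a (compl a) = top.
Proof.
apply: below_anti (below_top _) _.
rewrite (antiB _ _ (cupE a (compl a))).
exact/cap_below_imp/cap_belowr.
Qed.

HB.instance Definition _ := gen_eqMixin T.
HB.instance Definition _ := gen_choiceMixin T.

(** The order structures take a boolean relation; classical logic turns [below] into one. *)
Definition belowb (a b : T) : bool := `[< below (a : B) (b : B) >].

Lemma belowb_refl : reflexive belowb.
Proof. by move=> a; apply/asboolP. Qed.

Lemma belowb_anti : antisymmetric belowb.
Proof. by move=> a b /andP[/asboolP ab /asboolP ba]; apply: below_anti. Qed.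

Lemma belowb_trans : transitive belowb.
Proof.
by move=> b a c /asboolP ab /asboolP bc; apply/asboolP/(below_trans _ _ _ ab bc).
Qed.

HB.instance Definition _ := Order.Le_isPOrder.Build (Order.Disp tt tt) T
  belowb_refl belowb_anti belowb_trans.

(** Together with [cup_belowb], this gives the universal properties from which the lattice
    identities are derived. *)
Lemma belowb_cap (a b c : T) :
  (a <= (cap (b : B) (c : B) : T))%O = (a <= b)%O && (a <= c)%O.
Proof.
apply/asboolP/andP => [/below_cap[ab ac]|[/asboolP ab /asboolP ac]].
  by split; apply/asboolP.
exact/below_cap.
Qed.

Lemma cup_belowb (a b c : T) :
  ((cup (a : B) (b : B) : T) <= c)%O = (a <= c)%O && (b <= c)%O.
Proof.
apply/asboolP/andP => [/cup_below[ab ac]|[/asboolP ab /asboolP ac]].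
  by split; apply/asboolP.
exact/cup_below.
Qed.

HB.instance Definition _ := Order.POrder_MeetJoin_isLattice.Build _ T
  belowb_cap cup_belowb.

Lemma belowb_bot (a : T) : (((bot : B) : T) <= a)%O.
Proof. exact/asboolP/bot_below. Qed.

Lemma belowb_top (a : T) : (a <= ((top : B) : T))%O.
Proof. exact/asboolP/below_top. Qed.

HB.instance Definition _ := Order.hasBottom.Build _ T belowb_bot.
HB.instance Definition _ := Order.hasTop.Build _ T belowb_top.
HB.instance Definition _ :=
  Order.Lattice_Meet_isDistrLattice.Build _ T cap_cupl.
HB.instance Definition _ :=
  Order.TBDistrLattice_hasComplement.Build _ T cup_compl cap_compl.

Lemma is_boolean_algebra_reflexive : is_boolean_algebra B.
Proof.
(* [T] unfolds to [B], so its class is a structure on [B] itself and the constants, meets and joins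
   agree by conversion. *)
exists (Order.Disp tt tt), (Order.CTBDistrLattice.class T); split=> //.
  by move=> a b; split=> [ab|/asboolP//]; apply/asboolP.
(* Complements also agree by conversion; implication needs the second Boolean axiom. *)
by split=> // a b; rewrite -cup_complE.
Qed.

End ReflexiveCarrier.

Theorem theorem15 (B : booleanSemialgebraType) (antiB : antisymmetric_semialgebra B) :
  is_boolean_algebra B <-> below_reflexive B.
Proof.
split=> [[d [K [belowE _ _ _ _]]] a|]; last exact: is_boolean_algebra_reflexive.
exact/belowE/Order.POrderTheory.lexx.
Qed.
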